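(* There exists an absolute constant $c>0$ such that for every prime $p$ and every subset $A\subset\mathbb{F}_p$ with $|A|>1$, $$ \max\{|A+A|,\,|AA|\}\ \ge\ c\,\min\left\{\frac{|A|^{15/14}\max\bigl\{1,\ |A|^{1/7}p^{-1/14}\bigr\}}{(\log|A|)^{2/7}},\ \frac{|A|^{11/12}p^{1/12}}{(\log|A|)^{1/3}}\right\}. $$ In particular, there exists an absolute constant $c'>0$ such that for every prime $p$ and every subset $A\subset\mathbb{F}_p$ with $1<|A|<p^{7/13}(\log p)^{-4/13}$, $$ \max\{|A+A|,\,|AA|\}\ \ge\ c'\,\frac{|A|^{15/14}}{(\log|A|)^{2/7}}. $$
   Context: $\mathbb{F}_p$ is the field of residue classes modulo the prime $p$. For a non-empty $A\subset\mathbb{F}_p$, the sum set is $A+A=\{a+b:\ a\in A,\ b\in A\}$ and the product set is $AA=\{ab:\ a\in A,\ b\in A\}$. $|X|$ denotes the cardinality of a finite set $X$, and $\log$ is the natural logarithm. The constants $c,c'$ do not depend on $p$ or $A$ (they are the implied constants of the Vinogradov symbol $\gg$). *)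

(* Defs.v *)
From mathcomp Require Import all_boot all_order all_algebra.

Set Implicit Arguments.
Unset Strict Implicit.
Unset Printing Implicit Defensive.

Import GRing.Theory.
Local Open Scope ring_scope.

Definition sumset (T : finNzRingType) (A : {set T}) : {set T} :=
  [set a + b | a in A, b in A].

Definition prodset (T : finNzRingType) (A : {set T}) : {set T} :=
  [set a * b | a in A, b in A].

(* Main.v *)
Require Import Defs.
From mathcomp Require Import all_boot all_order all_algebra.
From mathcomp Require Import reals sequences exp.
From mathcomp Require Import zify ring lra.

(* Let S = |A+A|, P = |AA|, M = max(S, P), and assume 0 is not in A. By the
   multiplicative energy bound and a dyadic pigeonhole there are b in A, N and a
   subset B of A with |aA :&: bA| >= N for all a in B, where N >> |A|^2 / P and
   N|B| >> |A|^3 / (P log|A|). Plunnecke's inequality for different summands,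
   with pivot bA, gives for a_i in B
     |a_1 A - a_2 A + a_3 A - a_4 A| << S^8 / (N^4 |A|^3).
   If the set (B-B)/(B-B) is the whole field, some set (a_3-a_4)B + (a_1-a_2)B
   has >> min(|B|^2, p) elements. Otherwise some xi = (a_1-a_2)/(a_3-a_4) has
   xi + 1 outside of (B-B)/(B-B), so that |B + (xi+1)B| = |B|^2, and Plunnecke's
   inequality gives |B|^3 << S |(a_3-a_4)B + (a_1-a_2)B|. Altogether
     |A|^14 << (log|A|)^3 M^13   or   p |A|^11 << M^12,
   which implies the theorem. *)

Set Implicit Arguments.
Unset Strict Implicit.
Unset Printing Implicit Defensive.

Import Order.TTheory GRing.Theory Num.Theory.
Local Open Scope ring_scope.

(** * Plunnecke and Ruzsa inequalities in a finite abelian group *)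

Section Plunnecke.
Variable V : finZmodType.
Implicit Types A B C X Y Z : {set V}.

(* [sumset A] is convertible to [addset A A]. *)
Definition addset A B : {set V} := [set a + b | a in A, b in B].

Lemma addsetS A A' B B' :
  A \subset A' -> B \subset B' -> addset A B \subset addset A' B'.
Proof.
move=> sA sB; apply/subsetP=> _ /imset2P[a b Aa Bb ->].
by apply: imset2_f; [apply: (subsetP sA) | apply: (subsetP sB)].
Qed.

Lemma addsetC A B : addset A B = addset B A.
Proof.
by apply/setP=> x; apply/imset2P/imset2P=> -[a b Aa Bb ->];
  exists b a => //; rewrite addrC.
Qed.

Lemma addset0r A : addset A [set 0] = A.
Proof.
apply/setP=> x; apply/imset2P/idP => [[a b Aa /set1P-> ->]|Ax].
  by rewrite addr0.
by exists x 0; rewrite ?addr0 ?set11.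
Qed.

Lemma card_addset_ge B Y : Y != set0 -> (#|B| <= #|addset Y B|)%N.
Proof.
case/set0Pn=> y Yy; rewrite -(card_imset _ (addrI y)); apply: subset_leq_card.
by apply/subsetP=> _ /imsetP[b Bb ->]; apply: imset2_f.
Qed.

Lemma card_addset_gt0 A B : A != set0 -> B != set0 -> (0 < #|addset A B|)%N.
Proof.
move=> A0 B0; apply: leq_trans (card_addset_ge _ A0).
by rewrite card_gt0.
Qed.

(* Petridis' lemma for a weighted family of summands: the weights are what
   makes it possible to treat several different summands at once. *)
Lemma weighted_petridis (I : finType) (B : I -> {set V}) (w : I -> nat) X :
  X != set0 ->
  exists Y, [/\ Y \subset X, Y != set0,
    ((\sum_i w i * #|addset Y (B i)|) * #|X|
       <= (\sum_i w i * #|addset X (B i)|) * #|Y|)%N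
    & forall C, (#|Y| * (\sum_i w i * #|addset Y (addset (B i) C)|)
        <= (\sum_i w i * #|addset Y (B i)|) * #|addset Y C|)%N].
Proof.
move=> X0; pose f Y := (\sum_i w i * #|addset Y (B i)|)%N.
pose P Y := (Y \subset X) && (Y != set0).
have PX : P X by rewrite /P subxx.
(* Petridis' choice: [Y] minimises f(Y)/|Y| over the non-empty subsets of [X]; [minY] is this
   minimality cleared of denominators. *)
case: (@arg_minP _ rat _ X P (fun Y => (f Y)%:R / #|Y|%:R) PX) => Y /andP[sYX Y0] Ymin.
have minY Z : Z \subset X -> (f Y * #|Z| <= f Z * #|Y|)%N.
  move=> sZ; have [->|Z0] := eqVneq Z set0; first by rewrite cards0 muln0.
  have /Ymin : P Z by rewrite /P sZ.
  rewrite ler_pdivlMr ?ltr0n ?card_gt0 // mulrAC ler_pdivrMr ?ltr0n ?card_gt0 //.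
  by rewrite -!natrM ler_nat.
exists Y; split=> //; first exact: minY.
move=> C; have [n] := ubnP #|C|; elim: n C => // n IHn C ltCn.
have [->|[c Cc]] := set_0Vmem C.
  rewrite big1 ?muln0 // => i _.
  suff ->: addset Y (addset (B i) set0) = set0 by rewrite cards0 muln0.
  by apply/setP=> x; rewrite inE; apply/imset2P=> -[u v _ /imset2P[b c _]]; rewrite inE.
set D := C :\ c; have{Cc} defC : C = c |: D by rewrite setD1K.
have{IHn ltCn} /IHn IH : (#|D| < n)%N by move: ltCn; rewrite defC cardsU1 setD11.
(* [Z] gathers the y whose translate by c is already in Y + D, so passing from D to C enlarges Y + D
   by exactly |Y| - |Z|. *)
pose Z := [set y in Y | y + c \in addset Y D].
have sZY : Z \subset Y by apply/subsetP=> y; rewrite inE => /andP[].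
have cardYC : (#|addset Y C| = #|addset Y D| + (#|Y| - #|Z|))%N.
  have dis : addset Y D :&: [set x + c | x in Y :\: Z] = set0.
    apply/setP=> x; rewrite !inE; apply/negP=> /andP[xD /imsetP[y]].
    by rewrite !inE => /andP[nZ Yy] xE; rewrite Yy -xE xD in nZ.
  rewrite -cardsDS // -(card_imset (mem (Y :\: Z)) (addIr c)) -cardsUI dis.
  rewrite cards0 addn0; congr #|pred_of_set _|.
  apply/setP=> x; apply/imset2P/setUP => [[y d Yy]|].
    rewrite defC => /setU1P[-> ->|Dd ->]; last by left; apply: imset2_f.
    have [?|nD] := boolP (y + c \in addset Y D); [by left | right].
    by apply: imset_f; rewrite !inE Yy nD.
  case=> [/imset2P[y d Yy Dd ->]|/imsetP[y /setDP[Yy _] ->]].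
    by exists y d => //; rewrite defC setU1r.
  by exists y c => //; rewrite defC setU11.
(* Since Z + c lies in Y + D, the set Z + B_i + c lies in Y + B_i + D. New elements can only come
   from translating (Y + B_i) minus (Z + B_i) by c. *)
have leYBC i : (#|addset Y (addset (B i) C)| + #|addset Z (B i)|
    <= #|addset Y (addset (B i) D)| + #|addset Y (B i)|)%N.
  have sZB : addset Z (B i) \subset addset Y (B i) by apply: addsetS.
  rewrite -(subnK (subset_leq_card sZB)) addnA leq_add2r -cardsDS //.
  rewrite -(card_imset (mem (addset Y (B i) :\: _)) (addIr c)).
  apply: leq_trans (leq_card_setU _ _); apply: subset_leq_card.
  apply/subsetP=> _ /imset2P[y _ Yy /imset2P[b d Bb Cd ->] ->].
  move: Cd; rewrite defC => /setU1P[->|Dd]; apply/setUP; last first.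
    by left; rewrite !imset2_f.
  have [/imset2P[z b' Zz Bb' eq_yb]|nZ] := boolP (y + b \in addset Z (B i)).
    left; rewrite addrA eq_yb addrAC.
    move: Zz; rewrite inE => /andP[_ /imset2P[y' d' Yy' Dd' ->]].
    by rewrite -addrA [d' + _]addrC !imset2_f.
  by right; apply/imsetP; exists (y + b); rewrite ?addrA // inE nZ imset2_f.
(* Minimality against [Z] bounds the growth f(Y) - f(Z) by (f(Y)/|Y|)(|Y| - |Z|), which is what the
   growth of |Y + C| allows. *)
have leZ := minY _ (subset_trans sZY sYX); have leZY := subset_leq_card sZY.
pose g E := (\sum_i w i * #|addset Y (addset (B i) E)|)%N.
have leg : (g C + f Z <= g D + f Y)%N.
  rewrite -!big_split; apply: leq_sum => i _ /=.
  by rewrite -!mulnDr leq_mul2l leYBC orbT.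
rewrite -/(g C) -/(f Y) cardYC; move: IH; rewrite -/(g D) -/(f Y) => IH.
have := leq_mul (leqnn #|Y|) leg; rewrite mulnDr !mulnDr mulnBr.
rewrite [X in (_ + X <= _)%N]mulnC [in X in (_ <= X)%N](mulnC _ (f Y)); lia.
Qed.

(** Weighting each summand by the product of the other |X + B_j| makes all terms of the weighted sum
    for [X] equal, and the factor [size s] counts these terms. One [Y] serves every summand and
    every [C], so the bound can be iterated. *)
Lemma plunnecke (s : seq {set V}) X :
  X != set0 -> (forall B, B \in s -> B != set0) ->
  exists Y, [/\ Y \subset X, Y != set0
    & forall B C, B \in s ->
      (#|X| * #|addset Y (addset B C)|
         <= size s * #|addset X B| * #|addset Y C|)%N].
Proof.
move=> X0 s0; pose B (i : 'I_(size s)) := nth set0 s i.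
pose q i := #|addset X (B i)|; pose w i := (\prod_(j | j != i) q j)%N.
have q0 i : (0 < q i)%N by rewrite card_addset_gt0 // s0 // mem_nth.
have [Y [sYX Y0 minY leY]] := weighted_petridis B w X0; exists Y; split=> //.
have wq i : (w i * q i = \prod_j q j)%N by rewrite [RHS](bigD1 i) //= mulnC.
move=> _ C /(nthP set0)[k ltks <-].
pose i := Ordinal ltks; rewrite -[nth _ _ _]/(B i) -/(q i).
have w0 : (0 < w i)%N by apply: prodn_cond_gt0.
move: minY; under [in X in (_ <= X)%N]eq_bigr => j _ do rewrite -/(q j) wq.
rewrite sum_nat_const card_ord -(wq i) => minY.
have /(leq_trans _) le1 := leY C.
have {}le1 := le1 (#|Y| * (w i * #|addset Y (addset (B i) C)|))%N _.
have {le1}le1 := le1 ltac:(by rewrite leq_mul2l (bigD1 i) //= leq_addr orbT).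
have Ypos : (0 < #|Y|)%N by rewrite card_gt0.
rewrite -(leq_pmul2l w0) -(leq_pmul2l Ypos).
set t := (\sum_j _)%N in minY le1; set u := #|addset Y C| in le1 *.
have := leq_mul (leqnn #|X|) le1; have := leq_mul minY (leqnn u).
set v := #|addset Y (addset _ _)|; set x := #|X|; set y := #|Y|; set n := size s.
move=> h1 h2.
have -> : (y * (w i * (x * v)) = x * (y * (w i * v)))%N by ring.
apply: leq_trans h2 _; have -> : (x * (t * u) = t * x * u)%N by ring.
by apply: leq_trans h1 _; apply: eq_leq; ring.
Qed.

Definition sumsets (s : seq {set V}) := foldr addset [set 0] s.

Lemma card_sumsets (s : seq {set V}) X :
  X != set0 -> (forall B, B \in s -> B != set0) ->
  exists Y, [/\ Y \subset X, Y != set0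
    & (#|X| ^ size s * #|addset Y (sumsets s)|
       <= size s ^ size s * (\prod_(B <- s) #|addset X B|) * #|Y|)%N].
Proof.
move=> X0 s0; have [Y [sYX Y0 leY]] := plunnecke X0 s0.
exists Y; split=> //.
(* The summands are peeled off one at a time, [C] being the sum of the remaining ones. [Y] and the
   base [size s] stay those of the full list. *)
suff key r : {subset r <= s} -> (#|X| ^ size r * #|addset Y (sumsets r)|
    <= size s ^ size r * (\prod_(B <- r) #|addset X B|) * #|Y|)%N by exact: key.
elim: r => [|B r IHr] srs /=; first by rewrite big_nil addset0r.
have sB : B \in s by apply: srs; rewrite mem_head.
have {}/IHr IHr : {subset r <= s} by move=> C rC; apply: srs; rewrite inE rC orbT.
rewrite big_cons !expnS -[(#|X| * _ * _)%N]mulnAC.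
apply: leq_trans (leq_mul (leY B (sumsets r) sB) (leqnn _)) _.
rewrite -mulnA [X in (_ * X)%N]mulnC.
by apply: leq_trans (leq_mul (leqnn _) IHr) _; apply: eq_leq; ring.
Qed.

Lemma card_sumsets_le (s : seq {set V}) X :
  X != set0 -> (forall B, B \in s -> B != set0) ->
  (#|X| ^ size s * #|sumsets s|
     <= size s ^ size s * (\prod_(B <- s) #|addset X B|) * #|X|)%N.
Proof.
move=> X0 s0; have [Y [sYX Y0 leY]] := card_sumsets X0 s0.
apply: leq_trans (leq_trans leY _); rewrite leq_mul ?card_addset_ge //.
exact: subset_leq_card.
Qed.

(** Fix a representation d = a - b for each d in A - B. The map (x, d) -> (x + a, x + b) is
    injective: the difference of the coordinates gives back d, hence a, and then x. *)
Lemma ruzsa_triangle A B X :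
  (#|X| * #|addset A [set - b | b in B]| <= #|addset X A| * #|addset X B|)%N.
Proof.
pose D := addset A [set - b | b in B].
pose rep d := odflt (0, 0) [pick ab : V * V | [&& ab.1 \in A, ab.2 \in B & d == ab.1 - ab.2]].
have repP d : d \in D -> [/\ (rep d).1 \in A, (rep d).2 \in B & d = (rep d).1 - (rep d).2].
  move=> /imset2P[a _ Aa /imsetP[b Bb ->] dE]; rewrite /rep.
  case: pickP => [ab /and3P[? ? /eqP] //|/(_ (a, b))].
  by rewrite /= Aa Bb dE eqxx.
pose h (xd : V * V) := (xd.1 + (rep xd.2).1, xd.1 + (rep xd.2).2).
rewrite -!cardsX -(card_in_imset (f := h)).
  apply: subset_leq_card; apply/subsetP=> _ /imsetP[[x d] /setXP[Xx /repP[? ? _]] ->].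
  by rewrite inE !imset2_f.
move=> [x d] [y e] /setXP[_ /repP[_ _ /= dE]] /setXP[_ /repP[_ _ /= eE]] [e1 e2].
have de : d = e.
  have sub2l (z u v : V) : z + u - (z + v) = u - v by rewrite opprD addrACA subrr add0r.
  by rewrite [LHS]dE [RHS]eE -(sub2l x) -(sub2l y (rep e).1) e1 e2.
by move: e1; rewrite de => /addIr ->.
Qed.
End Plunnecke.

(** The double sum is the sum of the squared fibre sizes of [f] on [D], while |D| is the sum of the
    fibre sizes. *)
Lemma cauchy_schwarz_card (T U : finType) (D : {set T}) (f : T -> U) :
  (#|D| ^ 2 <= #|f @: D| *
     \sum_(x in D) \sum_(y in D) (f x == f y))%N.
Proof.
pose r z := #|[set x in D | f x == z]|.
have cardD : #|D| = (\sum_(z in f @: D) r z)%N.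
  rewrite -sum1_card (partition_big_imset f) /=; apply: eq_bigr => z _.
  by rewrite /r -sum1_card; apply: eq_bigl => x; rewrite inE.
have -> : (\sum_(x in D) \sum_(y in D) (f x == f y) = \sum_(z in f @: D) r z ^ 2)%N.
  rewrite (partition_big_imset f) /=; apply: eq_bigr => z _.
  rewrite -mulnn {1}/r -sum1_card big_distrl /=.
  under [RHS]eq_bigl => x do rewrite inE.
  apply: eq_bigr => x /andP[_ /eqP->]; rewrite mul1n /r -sum1_card.
  rewrite [RHS](eq_bigl (fun y => (y \in D) && (f y == z))); last by move=> y; rewrite inE.
  rewrite big_mkcondr; apply: eq_bigr => y _; by rewrite eq_sym; case: eqP.
rewrite cardD -mulnn -(leq_pmul2l (isT : 0 < 2)%N) big_distrlr big_distrr /=.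
under eq_bigr => z _ do rewrite big_distrr /=.
set B := f @: D; apply: (@leq_trans (\sum_(z in B) \sum_(w in B) (r z ^ 2 + r w ^ 2))).
  by do 2!(apply: leq_sum => ? _); rewrite nat_Cauchy.
under eq_bigr => z _ do rewrite big_split sum_nat_const /=.
by rewrite big_split sum_nat_const -big_distrr /=; lia.
Qed.

(** * Sums and differences of dilates of one set *)

Section Dilates.
Variable F : finFieldType.
Implicit Types A B X Y : {set F}.

Definition dilate (c : F) A : {set F} := [set c * x | x in A].
#[global] Arguments dilate c%_R A.

Lemma card_dilate c A : c != 0 -> #|dilate c A| = #|A|.
Proof. by move=> /mulfI; apply: card_imset. Qed.

Lemma dilate_neq0 c A : A != set0 -> dilate c A != set0.
Proof. by case/set0Pn=> x Ax; apply/set0Pn; exists (c * x); apply: imset_f. Qed.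

Lemma dilateD c A B : addset (dilate c A) (dilate c B) = dilate c (addset A B).
Proof.
apply/setP=> x; apply/imset2P/imsetP => [[_ _ /imsetP[a Aa ->] /imsetP[b Bb ->] ->]|].
  by exists (a + b); rewrite ?imset2_f ?mulrDr.
case=> _ /imset2P[a b Aa Bb ->] ->.
by exists (c * a) (c * b); rewrite ?imset_f ?mulrDr.
Qed.

Lemma card_addset_dilate c A B :
  c != 0 -> #|addset (dilate c A) (dilate c B)| = #|addset A B|.
Proof. by move=> c0; rewrite dilateD card_dilate. Qed.

(** With pivot X = aA :&: bA, the set X + aA lies in a(A + A) and X + bA in b(A + A). The factor 4 =
    2^2 is that of Plunnecke's inequality for two summands. *)
Lemma card_addset_dilates a b A N :
    a != 0 -> b != 0 -> (0 < N <= #|dilate a A :&: dilate b A|)%N ->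
  (N * #|addset (dilate a A) (dilate b A)| <= 4 * #|addset A A| ^ 2)%N.
Proof.
move=> a0 b0 /andP[N0 leN]; set X := _ :&: _ in leN.
have X0 : X != set0 by rewrite -card_gt0 (leq_trans N0).
have [x /setIP[aAx bAx]] := set0Pn _ X0.
have s0 B : B \in [:: dilate a A; dilate b A] -> B != set0.
  by rewrite !inE => /pred2P[->|->]; apply/set0Pn; exists x.
have := card_sumsets_le X0 s0.
rewrite /sumsets /= addset0r big_cons big_cons big_nil muln1.
have lea : (#|addset X (dilate a A)| <= #|addset A A|)%N.
  by rewrite -(card_addset_dilate A A a0) subset_leq_card ?addsetS ?subsetIl.
have leb : (#|addset X (dilate b A)| <= #|addset A A|)%N.
  by rewrite -(card_addset_dilate A A b0) subset_leq_card ?addsetS ?subsetIr.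
have := leq_mul lea leb; set u := (_ * _)%N; set S := #|addset A A|.
move=> leu; rewrite -mulnn -mulnA [X in (_ <= X)%N]mulnC leq_pmul2l ?card_gt0 // => le1.
by apply: leq_trans (leq_mul leN (leqnn _)) (leq_trans le1 _); rewrite leq_mul2l -mulnn leu orbT.
Qed.

(** The same pivot in Ruzsa's triangle inequality; the factor 4 is slack that matches the bound for
    sums. *)
Lemma card_subset_dilates a b A N :
    a != 0 -> b != 0 -> (0 < N <= #|dilate a A :&: dilate b A|)%N ->
  (N * #|addset (dilate b A) [set - x | x in dilate a A]| <= 4 * #|addset A A| ^ 2)%N.
Proof.
move=> a0 b0 /andP[N0 leN]; set X := _ :&: _ in leN.
have lea : (#|addset X (dilate a A)| <= #|addset A A|)%N.
  by rewrite -(card_addset_dilate A A a0) subset_leq_card ?addsetS ?subsetIl.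
have leb : (#|addset X (dilate b A)| <= #|addset A A|)%N.
  by rewrite -(card_addset_dilate A A b0) subset_leq_card ?addsetS ?subsetIr.
have := ruzsa_triangle (dilate b A) (dilate a A) X.
move=> /(leq_trans (leq_mul leN (leqnn _))) /leq_trans -> //.
by apply: leq_trans (leq_mul leb lea) _; rewrite mulnn leq_pmull.
Qed.

(** The sum lies in a3 A - a4 A + a1 A - a2 A, bounded with pivot bA. In 4^8, one factor 4^4 comes
    from having four summands and the other from the four bounds on bA + a_i A or bA - a_i A. *)
Lemma card_sum_of_dilates A (b a1 a2 a3 a4 : F) N : A != set0 -> b != 0 -> (0 < N)%N ->
    (forall a, a \in [:: a1; a2; a3; a4] ->
       (a != 0) && (N <= #|dilate a A :&: dilate b A|)%N) ->
  (N ^ 4 * #|A| ^ 3 * #|addset (dilate (a3 - a4) A) (dilate (a1 - a2) A)|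
     <= 4 ^ 8 * #|addset A A| ^ 8)%N.
Proof.
move=> A0 b0 N0 HN; pose op B := [set - x | x in B] : {set F}.
pose s := [:: dilate a3 A; op (dilate a4 A); dilate a1 A; op (dilate a2 A)].
have sub : addset (dilate (a3 - a4) A) (dilate (a1 - a2) A) \subset sumsets s.
  apply/subsetP=> _ /imset2P[_ _ /imsetP[x Ax ->] /imsetP[y Ay ->] ->].
  rewrite /sumsets /= addset0r.
  have -> : (a3 - a4) * x + (a1 - a2) * y = a3 * x + (- (a4 * x) + (a1 * y + - (a2 * y))).
    by ring.
  by rewrite !imset2_f ?imset_f.
have s0 B : B \in s -> B != set0.
  rewrite !inE => /or4P[] /eqP-> ; rewrite ?dilate_neq0 //;
  by have [x Ax] := set0Pn _ A0; apply/set0Pn; eexists; apply: imset_f; apply: imset_f; exact: Ax.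
have := card_sumsets_le (dilate_neq0 b A0) s0.
rewrite !big_cons big_nil card_dilate // muln1 (_ : size s = 4) //.
have bnd a : a \in [:: a1; a2; a3; a4] ->
    (N * #|addset (dilate b A) (dilate a A)| <= 4 * #|addset A A| ^ 2)%N /\
    (N * #|addset (dilate b A) (op (dilate a A))| <= 4 * #|addset A A| ^ 2)%N.
  move=> /HN /andP[a0 leN].
  by rewrite addsetC; split;
    [apply: card_addset_dilates | apply: card_subset_dilates]; rewrite ?N0.
have [[h3 _] [_ h4]] := (bnd a3 ltac:(by rewrite !inE eqxx !orbT),
                         bnd a4 ltac:(by rewrite !inE eqxx !orbT)).
have [[h1 _] [_ h2]] := (bnd a1 ltac:(by rewrite !inE eqxx),
                         bnd a2 ltac:(by rewrite !inE eqxx !orbT)).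
have := leq_mul (leq_mul h3 h4) (leq_mul h1 h2).
move: (subset_leq_card sub) => leU.
set u3 := #|addset _ (dilate a3 _)|; set u4 := #|addset _ (op (dilate a4 _))|.
set u1 := #|addset _ (dilate a1 _)|; set u2 := #|addset _ (op (dilate a2 _))|.
set S := #|addset A A|; move=> le1 le2.
have Apos : (0 < #|A|)%N by rewrite card_gt0.
have le3 : (#|A| ^ 3 * #|sumsets s| <= 4 ^ 4 * (u3 * (u4 * (u1 * u2))))%N.
  by rewrite -(leq_pmul2l Apos) mulnA -expnS [X in (_ <= X)%N]mulnC.
apply: leq_trans (leq_mul (leqnn _) leU) _; rewrite -mulnA.
apply: leq_trans (leq_mul (leqnn _) le3) _.
rewrite mulnCA (expnD 4 4 4 : 4 ^ 8 = _)%N -mulnA leq_mul2l.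
move: le1; set c := 4%N; set t := (_ * _ * _)%N => le1; apply/orP; right.
have -> : (N ^ c * (u3 * (u4 * (u1 * u2))) = t)%N by rewrite /t /c; ring.
by apply: leq_trans le1 _; apply: eq_leq; rewrite /c; ring.
Qed.
End Dilates.

(** * Expansion of A + cA and the quotient set (A - A)/(A - A) *)

Section Expansion.
Variable F : finFieldType.
Implicit Types A X Y : {set F}.

Lemma slope_eq (c x x' y y' : F) :
  x + c * y = x' + c * y' -> y != y' -> c = (x - x') / (y' - y).
Proof.
move=> e neqy; have n0 : y' - y != 0 by rewrite subr_eq0 eq_sym.
apply: (mulIf n0); rewrite divfK //.
have -> : c * (y' - y) = x - x' + (x' + c * y' - (x + c * y)) by ring.
by rewrite e subrr addr0.
Qed.

(** These are exactly the c for which (x, y) -> x + cy is not injective on A x A. *)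
Definition ratios A : {set F} :=
  [set (x.1.1 - x.1.2) / (x.2.1 - x.2.2)
    | x in [pred x : (F * F) * (F * F) | [&& x.1.1 \in A, x.1.2 \in A,
        x.2.1 \in A, x.2.2 \in A & x.2.1 != x.2.2]]].

Lemma ratiosP A c :
  reflect (exists a1 a2 a3 a4, [/\ [/\ a1 \in A, a2 \in A, a3 \in A & a4 \in A],
             a3 != a4 & c = (a1 - a2) / (a3 - a4)])
          (c \in ratios A).
Proof.
apply: (iffP imsetP) => [[[[a1 a2] [a3 a4]]]|[a1 [a2 [a3 [a4 [[? ? ? ?] ? ->]]]]]].
  by rewrite inE => /and5P[/= ? ? ? ? ?] ->; exists a1, a2, a3, a4.
by exists ((a1, a2), (a3, a4)) => //; rewrite inE; apply/and5P.
Qed.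

Lemma card_addset_dilate_nratio A X c :
  c \notin ratios A -> X \subset A ->
  #|addset X (dilate c A)| = (#|X| * #|A|)%N.
Proof.
move=> nc sXA; rewrite -cardsX.
rewrite -(card_in_imset (f := fun x : F * F => x.1 + c * x.2)).
  congr #|pred_of_set _|; apply/setP=> z; apply/imset2P/imsetP.
    by case=> x _ Xx /imsetP[y Ay ->] ->; exists (x, y); rewrite ?inE ?Xx.
  by case=> -[x y] /setXP[Xx Ay] ->; exists x (c * y); rewrite ?imset_f.
move=> [x y] [x' y'] /setXP[/= Xx Ay] /setXP[/= Xx' Ay'] /= e.
have [eqy|neqy] := eqVneq y y'; first by move: e; rewrite eqy => /addIr->.
case/negP: nc; apply/ratiosP; exists x, x', y', y.
split; [by split=> //; apply: (subsetP sXA) | by rewrite eq_sym |].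
exact: slope_eq.
Qed.

(* On average over c, the representation count of A + cA is at most
   |A|^2 + |A|^4 / |F|. *)
Lemma exists_large_addset_dilate A : A != set0 ->
  exists c, (#|F| * #|A| ^ 2 <= (#|F| + #|A| ^ 2) * #|addset A (dilate c A)|)%N.
Proof.
move=> A0; pose D := setX A A; pose f c (x : F * F) := x.1 + c * x.2.
pose E c := (\sum_(x in D) \sum_(y in D) (f c x == f c y))%N.
have cardD : #|D| = (#|A| ^ 2)%N by rewrite cardsX mulnn.
have sumE : (\sum_c E c <= #|F| * #|D| + #|D| ^ 2)%N.
  rewrite exchange_big /=; under eq_bigr => x _ do rewrite exchange_big /=.
  (* Distinct pairs collide for at most one c, the slope [c0]. If their second coordinates agree,
     [c0] is a dummy value and no c gives a collision. *)
  have le x y : (\sum_c (f c x == f c y) <= #|F| * (x == y) + 1)%N.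
    have [->|neq] := eqVneq x y.
      under eq_bigr => c _ do rewrite eqxx.
      by rewrite sum1_card muln1 leq_addr.
    rewrite muln0 add0n; pose c0 := (x.1 - y.1) / (y.2 - x.2).
    apply: (@leq_trans (\sum_(c : F) (c == c0))); last first.
      by rewrite (bigD1 c0) //= eqxx big1 ?addn0 // => c /negPf->.
    apply: leq_sum => c _; rewrite /f; case: eqP => // e; rewrite lt0b.
    case: x y neq @c0 e => [x1 x2] [y1 y2] /= neq e.
    apply/eqP/slope_eq => //.
    by apply: contraNneq neq => e2; move: e; rewrite e2 => /addIr ->.
  apply: (@leq_trans (\sum_(x in D) \sum_(y in D) (#|F| * (x == y) + 1))).
    by do 2!(apply: leq_sum => ? _).
  under eq_bigr => x Dx.
    rewrite big_split /= sum1_card -big_distrr /= (bigD1 x) //= eqxx big1 ?addn0.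
      rewrite muln1; over.
    by move=> y /andP[_]; rewrite eq_sym => /negPf->.
  by rewrite sum_nat_const mulnDr mulnn mulnC.
have [c leE] : exists c, (#|F| * E c <= #|F| * #|D| + #|D| ^ 2)%N.
  apply/existsP; apply: contraLR sumE => /existsPn /= ltE; rewrite -ltnNge.
  have F0 : (0 < #|F|)%N by apply/card_gt0P; exists 0.
  rewrite -(ltn_pmul2l F0) big_distrr /=.
  apply: (@leq_trans (\sum_(c : F) (#|F| * #|D| + #|D| ^ 2).+1)%N).
    by rewrite sum_nat_const ltn_pmul2l.
  by apply: leq_sum => c _; rewrite ltnNge.
exists c; have := cauchy_schwarz_card D (f c); rewrite -/(E c).
have -> : f c @: D = addset A (dilate c A).
  apply/setP=> z; apply/imsetP/imset2P.
    by case=> -[x y] /setXP[Xx Ay] ->; exists x (c * y); rewrite ?imset_f.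
  by case=> x _ Xx /imsetP[y Ay ->] ->; exists (x, y); rewrite ?inE ?Xx.
set s := #|addset _ _|; rewrite -cardD => leD.
have D0 : (0 < #|D|)%N by rewrite cardD expn_gt0 card_gt0 A0.
rewrite -(leq_pmul2l D0).
have -> : (#|D| * (#|F| * #|D|) = #|F| * #|D| ^ 2)%N by rewrite mulnCA mulnn.
apply: leq_trans (leq_mul (leqnn _) leD) _; rewrite mulnCA.
by apply: leq_trans (leq_mul (leqnn s) leE) _; apply: eq_leq; ring.
Qed.

(* A + (d/c + 1)A has |A|^2 elements and its c-dilate lies in cA + cA + dA. The
   subset Y of cA given by Plunnecke's inequality may be small: this is harmless,
   because |Y + (d + c)A| = |Y||A| is also proportional to |Y|. *)
Lemma pivot_expansion A c :
    A != set0 -> c != 0 -> forall d, d / c + 1 \notin ratios A ->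
  (#|A| ^ 3 <= 4 * #|addset A A| * #|addset (dilate c A) (dilate d A)|)%N.
Proof.
move=> A0 c0 d nr; pose B := dilate c A; have B0 := dilate_neq0 c A0.
pose s := [:: B; dilate d A].
have s0 C : C \in s -> C != set0 by rewrite !inE => /pred2P[] ->; apply: dilate_neq0.
have [Y [sYB Y0]] := card_sumsets B0 s0.
rewrite !big_cons big_nil muln1 /= /sumsets /= addset0r card_addset_dilate //.
rewrite card_dilate //.
(* Undoing the dilation turns [Y] into a subset [Z] of A, where d/c + 1 not being a ratio gives |Z +
   (d/c + 1)A| = |Z||A|. *)
have leY : (#|Y| * #|A| <= #|addset Y (addset B (dilate d A))|)%N.
  pose Z := dilate c^-1 Y.
  have ZE : Y = dilate c Z.
    rewrite /Z /dilate -imset_comp -[LHS]imset_id; apply: eq_imset => x /=.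
    by rewrite mulVKf.
  have sZA : Z \subset A.
    apply/subsetP=> _ /imsetP[y /(subsetP sYB) /imsetP[a Aa ->] ->].
    by rewrite mulKf.
  rewrite -{1}(card_dilate Y (invr_neq0 c0)) -(card_addset_dilate_nratio nr sZA).
  rewrite -(card_dilate _ c0) -dilateD -ZE; apply/subset_leq_card/addsetS => //.
  apply/subsetP=> _ /imsetP[_ /imsetP[a Aa ->] ->].
  rewrite (_ : c * _ = c * a + d * a) ?imset2_f ?imset_f //.
  by rewrite mulrA mulrDr mulr1 mulrCA divff // mulr1 mulrDl addrC.
move=> le1; have Ypos : (0 < #|Y|)%N by rewrite card_gt0.
rewrite -(leq_pmul2l Ypos).
have := leq_mul (leqnn (#|A| ^ 2)) leY; move=> /leq_trans/(_ le1).
rewrite -[dilate c A]/B; set u := #|addset A A|; set v := #|addset B _| => le2.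
have -> : (#|Y| * #|A| ^ 3 = #|A| ^ 2 * (#|Y| * #|A|))%N by ring.
by apply: leq_trans le2 _; apply: eq_leq; ring.
Qed.

End Expansion.

(** * Expansion over a prime field *)

Lemma Fp_ind (p : nat) (P : 'F_p -> Prop) :
  P 0 -> (forall x, P x -> P (x + 1)) -> forall x, P x.
Proof.
by move=> P0 PS x; rewrite -[x]natr_Zp; elim: (x : nat) => // n IH; rewrite -addn1 natrD; apply: PS.
Qed.

Lemma sum_or_field_expansion (p : nat) (A : {set 'F_p}) : (1 < #|A|)%N ->
  exists a1 a2 a3 a4, [/\ a1 \in A, a2 \in A, a3 \in A & a4 \in A] /\
    let t := #|addset (dilate (a3 - a4) A) (dilate (a1 - a2) A)| in
    (#|A| ^ 3 <= 4 * #|addset A A| * t)%N \/ (#|'F_p| <= 4 * t)%N.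
Proof.
move=> /card_gt1P[x [y [Ax Ay neqxy]]].
have A0 : A != set0 by apply/set0Pn; exists x.
have [full|nfull] := altP (ratios A =P setT).
  have [c lec] := exists_large_addset_dilate A0.
  have : c \in ratios A by rewrite full.
  case/ratiosP=> a1 [a2 [a3 [a4 [As neq34 cE]]]]; exists a1, a2, a3, a4; split=> //=.
  have n34 : a3 - a4 != 0 by rewrite subr_eq0.
  move: lec; rewrite -(card_dilate (addset _ _) n34) -dilateD.
  have -> : dilate (a3 - a4) (dilate c A) = dilate (a1 - a2) A.
    rewrite /dilate -imset_comp; apply: eq_imset => z /=.
    by rewrite cE mulrA mulrC [_ * (_ / _)]mulrCA divff // mulr1 mulrC.
  have := card_addset_ge A A0; have : (0 < #|A| ^ 2)%N by rewrite expn_gt0 card_gt0 A0.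
  set t := #|addset _ (dilate _ _)|; set q := #|'F_p|; set n := (#|A| ^ 2)%N => n0 leA le1.
  (* The averaged bound reads q n <= (q + n) t. The larger of q and n cancels, leaving n <= 2t or q
     <= 2t. *)
  have [leq|ltq] := leqP n q; [left | right].
    have le2 : (n <= 2 * t)%N.
      rewrite -(leq_pmul2l (leq_trans n0 leq)); apply: leq_trans le1 _.
      by rewrite mulnA leq_mul2r muln2 -addnn leq_add2l leq orbT.
    rewrite expnS -mulnA mulnCA -/n.
    by apply: leq_trans (leq_mul leA le2) _; rewrite !leq_mul.
  rewrite -(leq_pmul2l n0) mulnC; apply: leq_trans le1 _.
  by rewrite mulnA leq_mul2r; apply/orP; right; lia.
(* The quotient set contains 0; were it closed under adding 1, it would be the whole prime field. *)
have [c cR nc] : exists2 c, c \in ratios A & c + 1 \notin ratios A.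
  apply/exists_inP; apply: contraNT nfull => /exists_inPn /= RS.
  apply/eqP/setP=> z; rewrite inE; elim/Fp_ind: z => [|z /RS]; last by rewrite negbK.
  by apply/ratiosP; exists x, x, x, y; rewrite subrr mul0r.
case/ratiosP: cR nc => a1 [a2 [a3 [a4 [As neq34 ->]]]] nc.
exists a1, a2, a3, a4; split=> //=; left; apply: pivot_expansion => //.
by rewrite subr_eq0.
Qed.

(** * Multiplicative energy and popular dilates *)

Lemma multiplicative_energy (F : finFieldType) (A : {set F}) : 0 \notin A ->
  (#|A| ^ 4 <= #|prodset A| *
     \sum_(b in A) \sum_(a in A) #|dilate a A :&: dilate b A|)%N.
Proof.
move=> nA0; have := cauchy_schwarz_card (setX A A) (fun x => x.1 * x.2).
have -> : [set x.1 * x.2 | x in setX A A] = prodset A.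
  apply/setP=> z; apply/imsetP/imset2P.
    by case=> -[x y] /setXP[Ax Ay] ->; exists x y.
  by case=> x y Ax Ay ->; exists (x, y); rewrite ?inE ?Ax.
rewrite cardsX mulnn -expnM => /leq_trans-> //; rewrite leq_mul2l; apply/orP; right.
rewrite (eq_bigl (fun x => (x.1 \in A) && (x.2 \in A))); last by case=> x y; rewrite inE.
rewrite -(pair_big (mem A) (mem A) (fun a x =>
  \sum_(y in setX A A) (a * x == y.1 * y.2)%R)%N) /=.
under eq_bigr => a Aa.
  under eq_bigr => x Ax.
    rewrite (eq_bigl (fun x => (x.1 \in A) && (x.2 \in A))); last by case=> u v; rewrite inE.
    rewrite -(pair_big (mem A) (mem A) (fun b y => nat_of_bool (a * x == b * y))) /=.
    over.
  rewrite exchange_big /=.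
  over.
rewrite exchange_big /=; apply: leq_sum => b Ab; apply: leq_sum => a Aa.
have inj c : c \in A -> injective ( *%R c).
  by move=> Ac; apply: mulfI; apply: contraNneq nA0 => <-.
(* A common element ax = by of aA and bA determines x and y, as a and b are non-zero; so the
   intersection counts the solutions of ax = by in A. *)
have -> : dilate a A :&: dilate b A = dilate a [set x in A | a * x \in dilate b A].
  apply/setP=> z; rewrite inE; apply/andP/imsetP.
    by case=> /imsetP[x Ax ->] bz; exists x; rewrite ?inE ?Ax.
  by case=> x; rewrite inE => /andP[Ax bx] ->; rewrite imset_f.
rewrite (card_imset _ (inj a Aa)) -sum1_card.
under [X in (_ <= X)%N]eq_bigl => x do rewrite inE.
rewrite big_mkcondr; apply: leq_sum => x Ax.
case: ifPn => [/imsetP[y0 Ay0 e]|nin].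
  rewrite (bigD1 y0) //= e eqxx big1 // => y /andP[_ /negPf ne].
  by rewrite (inj_eq (inj b Ab)) eq_sym ne.
rewrite big1 // => y Ay; case: eqP => // e; case/negP: nin.
by rewrite e imset_f.
Qed.

(** Points are classed by the binary logarithm of [f], and k maximises the upper bound 2^(k+1) times
    the class size. *)
Lemma dyadic_pigeonhole (T : finType) (A : {set T}) (f : T -> nat) n :
    (forall x, x \in A -> f x <= n)%N ->
  exists k, (\sum_(x in A) f x <=
    (trunc_log 2 n).+1 * (2 ^ k.+1 * #|[set x in A | 2 ^ k <= f x < 2 ^ k.+1]|))%N.
Proof.
move=> len; set l := trunc_log 2 n.
pose B k := [set x in A | 2 ^ k <= f x < 2 ^ k.+1]%N.
pose g (k : 'I_l.+1) := (2 ^ k.+1 * #|B k|)%N.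
pose k := [arg max_(k > ord0 : 'I_l.+1 ) g k]; exists k; rewrite -/(g k).
have maxk j : (g j <= g k)%N by rewrite /k; case: arg_maxnP => // i _; apply.
have clsP x : x \in A -> (trunc_log 2 (f x) < l.+1)%N.
  by move=> Ax; rewrite ltnS leq_trunc_log // len.
rewrite (partition_big (fun x => inord (trunc_log 2 (f x)) : 'I_l.+1) predT) //=.
apply: (@leq_trans (\sum_(j < l.+1) g k)); last by rewrite sum_nat_const card_ord.
apply: leq_sum => j _; apply: leq_trans (maxk j); rewrite /g mulnC -sum_nat_const.
rewrite big_mkcond [X in (_ <= X)%N]big_mkcond; apply: leq_sum => x _.
case: ifP => // /andP[Ax /eqP jE].
(* A point with f x = 0 is put in class 0 by the default value of [trunc_log], but contributes
   nothing. *)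
have [->|fx0] := posnP (f x); first by case: ifP.
have {}jE : trunc_log 2 (f x) = j by rewrite -jE inordK // clsP.
have := trunc_logP (isT : 1 < 2)%N fx0; have := trunc_log_ltn (f x) (isT : 1 < 2)%N.
by rewrite jE inE Ax => lt ge; rewrite ge lt /= ltnW.
Qed.

Lemma popular_dilates (F : finFieldType) (A : {set F}) : 0 \notin A -> A != set0 ->
  exists b N (B : {set F}), [/\ b \in A, B \subset A /\ (0 < N)%N,
    forall a, a \in B -> (N <= #|dilate a A :&: dilate b A|)%N,
    (#|A| ^ 2 <= 4 * #|prodset A| * N)%N
  & (#|A| ^ 3 <= 4 * #|prodset A| * (trunc_log 2 #|A|).+1 * N * #|B|)%N].
Proof.
move=> nA0 A0; set P := #|prodset A|; set l := (trunc_log 2 _).+1.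
have Apos : (0 < #|A|)%N by rewrite card_gt0.
pose f b a := #|dilate a A :&: dilate b A|.
have [b Ab leb] : exists2 b, b \in A & (#|A| ^ 3 <= P * \sum_(a in A) f b a)%N.
  apply/exists_inP; apply: contraLR (multiplicative_energy nA0) => /exists_inPn /= ltb.
  rewrite -ltnNge big_distrr /= expnS -sum_nat_const.
  have [b Ab] := set0Pn _ A0; rewrite (bigD1 b) //= [X in (_ < X)%N](bigD1 b) //=.
  have lt b' : b' \in A -> (P * \sum_(a in A) f b' a < #|A| ^ 3)%N by move=> /ltb; rewrite -ltnNge.
  rewrite -addSn leq_add ?lt //.
  by apply: leq_sum => b' /andP[/lt /ltnW].
(* The a with f b a below |A|^2 / (2P) carry at most half of the mass. Discarding them before the
   pigeonholing is what bounds N from below. *)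
pose A' := [set a in A | #|A| ^ 2 <= 2 * P * f b a]%N.
have leA' : (#|A| ^ 3 <= 2 * P * \sum_(a in A') f b a)%N.
  have lt2 : (2 * P * \sum_(a in A :\: A') f b a <= #|A| ^ 3)%N.
    rewrite big_distrr /= expnS.
    apply: (@leq_trans (\sum_(a in A :\: A') #|A| ^ 2)%N).
      apply: leq_sum => a; rewrite !inE => /andP[+ Aa].
      by rewrite Aa /= -ltnNge => /ltnW.
    by rewrite sum_nat_const leq_mul2r subset_leq_card ?orbT // subsetDl.
  have sA' : A' \subset A by apply/subsetP=> a; rewrite inE => /andP[].
  move: leb; rewrite (big_setID A') /= (setIidPr sA'); move: lt2.
  set s1 := (\sum_(a in A') _)%N; set s2 := (\sum_(a in A :\: A') _)%N.
  rewrite mulnDr -!mulnA; move: (P * s1)%N (P * s2)%N (#|A| ^ 3)%N => u v w; lia.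
have lef a : a \in A' -> (f b a <= #|A|)%N.
  move=> _; apply: leq_trans (subset_leq_card (subsetIl _ _)) _; exact: leq_imset_card.
have [k] := dyadic_pigeonhole lef; set B := [set x in A' | _]; rewrite -/l => lek.
have le3 : (#|A| ^ 3 <= 4 * P * l * 2 ^ k * #|B|)%N.
  apply: leq_trans leA' _; apply: leq_trans (leq_mul (leqnn _) lek) _.
  by rewrite expnS; apply: eq_leq; ring.
exists b, (2 ^ k)%N, B; split=> //.
- split; last by rewrite expn_gt0.
  by apply/subsetP=> a; rewrite !inE => /andP[/andP[]].
- by move=> a; rewrite inE => /and3P[].
(* Any a in B satisfies both |A|^2 <= 2P f b a and f b a < 2N, where N = 2^k. *)
have [B0|[a]] := set_0Vmem B.
  by move: le3; rewrite B0 cards0 muln0 leqn0 expn_eq0 eqn0Ngt Apos.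
rewrite !inE => /and3P[/andP[_ h1] _ h2]; apply: leq_trans h1 _.
have -> : (4 * P * 2 ^ k = 2 * P * 2 ^ k.+1)%N by rewrite expnS; ring.
by rewrite leq_mul2l (ltnW h2) orbT.
Qed.

(** * The sum-product dichotomy in integer form *)

Lemma sum_product_dichotomy_nz (p : nat) (A : {set 'F_p}) M :
    0 \notin A -> A != set0 -> (#|sumset A| <= M)%N -> (#|prodset A| <= M)%N ->
  (#|A| ^ 14 <= 4 ^ 13 * (trunc_log 2 #|A|).+1 ^ 3 * M ^ 13)%N \/
  (#|'F_p| * #|A| ^ 11 <= 4 ^ 13 * M ^ 12)%N.
Proof.
move=> nA0 A0 leS leP; have [b [N [B [Ab [sBA N0] leN]]]] := popular_dilates nA0 A0.
set l := (trunc_log 2 #|A|).+1; set P := #|prodset A| in leP *; set n := #|A| => le2 le3.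
have Apos : (0 < n)%N by rewrite card_gt0.
have leAM : (n <= M)%N by apply: leq_trans (card_addset_ge A A0) leS.
have nz a : a \in A -> a != 0 by move=> Aa; apply: contraNneq nA0 => <-.
have B0 : B != set0.
  by apply/eqP=> B0; move: le3; rewrite B0 cards0 muln0 leqn0 expn_eq0 eqn0Ngt Apos.
have [i|ii] : (N ^ 4 * n ^ 3 * #|B| ^ 3 <= 4 ^ 9 * M ^ 9)%N \/
          (#|'F_p| * (N ^ 4 * n ^ 3) <= 4 ^ 9 * M ^ 8)%N.
(* A single-element B has no ratios, but then N <= |A| <= M suffices. *)
- have [leB|gtB] := leqP #|B| 1.
    left; have [x Bx] := set0Pn _ B0.
    have leNn : (N <= n)%N.
      apply: leq_trans (leN _ Bx) _; apply: leq_trans (subset_leq_card (subsetIl _ _)) _.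
      exact: leq_imset_card.
    have -> : (4 ^ 9 * M ^ 9 = M ^ 4 * M ^ 3 * (4 ^ 9 * M ^ 2))%N by ring.
    apply: leq_mul; first by rewrite leq_mul ?leq_exp2r // (leq_trans leNn).
    apply: (@leq_trans 1); first by case: #|B| leB => [|[]].
    by rewrite muln_gt0 !expn_gt0 (leq_trans Apos leAM).
  have [a1 [a2 [a3 [a4 [[B1 B2 B3 B4]]]]]] := sum_or_field_expansion gtB.
  set t := #|_| => /= alt.
  have let_ : (N ^ 4 * n ^ 3 * t <= 4 ^ 8 * M ^ 8)%N.
    have H a : a \in [:: a1; a2; a3; a4] -> (a != 0) && (N <= #|dilate a A :&: dilate b A|)%N.
      move=> Ha; have Ba : a \in B.
        by move: Ha; rewrite !inE => /or4P[] /eqP->.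
      by rewrite nz ?leN // (subsetP sBA).
    apply: leq_trans (leq_trans (card_sum_of_dilates A0 (nz _ Ab) N0 H) _).
      by rewrite leq_mul2l subset_leq_card ?orbT //; apply: addsetS; apply: imsetS.
    by rewrite leq_mul2l leq_exp2r // leS orbT.
  case: alt => alt; [left | right].
    have leBB : (#|addset B B| <= M)%N.
      by apply: leq_trans leS; apply/subset_leq_card/addsetS.
    apply: leq_trans (leq_mul (leqnn _) alt) _.
    have -> : (4 ^ 9 * M ^ 9 = 4 * M * (4 ^ 8 * M ^ 8))%N by ring.
    by rewrite mulnCA leq_mul // leq_mul.
  apply: leq_trans (leq_mul alt (leqnn _)) _.
  have -> : (4 ^ 9 * M ^ 8 = 4 * (4 ^ 8 * M ^ 8))%N by ring.
  by rewrite -mulnA leq_mul2l [X in (X <= _)%N]mulnC let_ orbT.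
(* One use of n^2 <= 4PN and three of n^3 <= 4PlN|B| produce exactly the N^4 |B|^3 that [i]
   bounds. *)
- left; have -> : (n ^ 14 = n ^ 2 * (n ^ 3) ^ 3 * n ^ 3)%N by ring.
  have h3 : ((n ^ 3) ^ 3 <= (4 * P * l * N * #|B|) ^ 3)%N by rewrite leq_exp2r.
  apply: leq_trans (leq_mul (leq_mul le2 h3) (leqnn _)) _.
  have -> : (4 * P * N * (4 * P * l * N * #|B|) ^ 3 * n ^ 3
             = 4 ^ 4 * l ^ 3 * P ^ 4 * (N ^ 4 * n ^ 3 * #|B| ^ 3))%N by ring.
  have hP : (P ^ 4 <= M ^ 4)%N by rewrite leq_exp2r.
  apply: leq_trans (leq_mul (leq_mul (leqnn _) hP) i) _.
  by apply: eq_leq; ring.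
(* Without |B| in the bound, four uses of n^2 <= 4PN give the N^4 needed for [ii]. *)
right; have -> : (n ^ 11 = (n ^ 2) ^ 4 * n ^ 3)%N by ring.
have h3 : ((n ^ 2) ^ 4 <= (4 * P * N) ^ 4)%N by rewrite leq_exp2r.
apply: leq_trans (leq_mul (leqnn _) (leq_mul h3 (leqnn _))) _.
set q := #|_| in ii *.
have -> : (q * ((4 * P * N) ^ 4 * n ^ 3) = 4 ^ 4 * P ^ 4 * (q * (N ^ 4 * n ^ 3)))%N by ring.
have hP : (P ^ 4 <= M ^ 4)%N by rewrite leq_exp2r.
apply: leq_trans (leq_mul (leq_mul (leqnn _) hP) ii) _.
by apply: eq_leq; ring.
Qed.

(** Removing 0 from A at most halves it, since |A| > 1. The loss 2^11 in the second alternative is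
    relaxed to 2^14 so that both share one constant. *)
Lemma sum_product_dichotomy (p : nat) (A : {set 'F_p}) M : prime p ->
    (1 < #|A|)%N -> (#|sumset A| <= M)%N -> (#|prodset A| <= M)%N ->
  (#|A| ^ 14 <= 2 ^ 14 * 4 ^ 13 * (trunc_log 2 #|A|).+1 ^ 3 * M ^ 13)%N \/
  (p * #|A| ^ 11 <= 2 ^ 14 * 4 ^ 13 * M ^ 12)%N.
Proof.
move=> pr_p gtA leS leP; pose B := A :\ 0.
have leAB : (#|A| <= 2 * #|B|)%N.
  by move: gtA; rewrite (cardsD1 0 A) -/B; move: #|B| => m; case: (0 \in A) => /=; lia.
have B0 : B != set0 
  by rewrite -card_gt0 -(ltn_pmul2l (isT : 0 < 2)%N) muln0 (leq_trans _ leAB) // ltnW.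
have sBA : B \subset A by apply: subsetDl.
have leSB : (#|sumset B| <= M)%N by apply: leq_trans leS; rewrite subset_leq_card ?imset2S.
have lePB : (#|prodset B| <= M)%N by apply: leq_trans leP; rewrite subset_leq_card ?imset2S.
have lel : ((trunc_log 2 #|B|).+1 <= (trunc_log 2 #|A|).+1)%N.
  by rewrite ltnS leq_trunc_log // subset_leq_card.
have nB0 : 0 \notin B by rewrite setD11.
have := sum_product_dichotomy_nz nB0 B0 leSB lePB; rewrite (card_Fp pr_p); move: (4 ^ 13)%N => K.
set n := #|A| in leAB lel *; set m := #|B| in leAB lel *.
set l := (trunc_log 2 m).+1 in lel *; set l' := (trunc_log 2 n).+1 in lel *.
have hl : (l ^ 3 <= l' ^ 3)%N by rewrite leq_exp2r.
have h14 : (n ^ 14 <= 2 ^ 14 * m ^ 14)%N by rewrite -expnMn leq_exp2r.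
have h11 : (n ^ 11 <= 2 ^ 14 * m ^ 11)%N.
  apply: (@leq_trans ((2 * m) ^ 11)); first by rewrite leq_exp2r.
  by rewrite expnMn leq_mul2r leq_exp2l ?orbT.
move: (2 ^ 14)%N h11 h14 => L h11 h14.
case=> [le14|le11]; [left | right].
  apply: leq_trans h14 (leq_trans (leq_mul (leqnn _) le14) _).
  apply: leq_trans (leq_mul (leqnn _) (leq_mul (leq_mul (leqnn _) hl) (leqnn _))) _.
  by apply: eq_leq; ring.
apply: leq_trans (leq_mul (leqnn p) h11) _; rewrite mulnCA.
by apply: leq_trans (leq_mul (leqnn _) le11) _; rewrite mulnA.
Qed.

(** * Passage to logarithms, where the estimates become linear, and the final bounds *)

Lemma sum_product_dichotomy_ln (R : realType) : exists k : R,
  forall (p : nat) (A : {set 'F_p}), prime p -> (1 < #|A|)%N ->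
    let alpha : R := ln #|A|%:R in
    let mu : R := ln (maxn #|sumset A| #|prodset A|)%:R in
    14 * alpha <= k + 3 * ln alpha + 13 * mu \/
    ln p%:R + 11 * alpha <= k + 12 * mu.
Proof.
have [K K0 HK] : exists2 K : nat, (0 < K)%N & forall p (A : {set 'F_p}) M, prime p ->
    (1 < #|A|)%N -> (#|sumset A| <= M)%N -> (#|prodset A| <= M)%N ->
    (#|A| ^ 14 <= K * (trunc_log 2 #|A|).+1 ^ 3 * M ^ 13)%N \/
    (p * #|A| ^ 11 <= K * M ^ 12)%N.
  by eexists; last exact: sum_product_dichotomy; rewrite muln_gt0 !expn_gt0.
have ln2 : 0 < ln 2 :> R by rewrite ln_gt0 ?ltr1n.
pose d : R := ln (2 / ln 2); exists (`|ln K%:R| + 3 * `|d|) => p A pr_p gtA alpha mu.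
have pos n : (0 < n)%N -> n%:R \in @Num.pos R by rewrite posrE ltr0n.
have A0 : (0 < #|A|)%N by apply: ltnW.
have alpha0 : 0 < alpha by rewrite ln_gt0 ?ltr1n.
set M := maxn _ _ in mu *.
have M0 : (0 < M)%N.
  rewrite leq_max; apply/orP; left.
  by apply: card_addset_gt0; rewrite -card_gt0.
have lnMn n m : (0 < n)%N -> (0 < m)%N -> ln (n * m)%:R = ln n%:R + ln m%:R :> R.
  by move=> n0 m0; rewrite natrM lnM ?pos.
have lnX n m : (0 < n)%N -> ln (n ^ m)%:R = m%:R * ln n%:R :> R.
  by move=> n0; rewrite natrX lnXn ?ltr0n // mulr_natl.
have leln n m : (0 < n)%N -> (n <= m)%N -> ln n%:R <= ln m%:R :> R.
  by move=> n0 lenm; rewrite ler_ln ?pos ?ler_nat // (leq_trans n0).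
have [leS leP] : (#|sumset A| <= M)%N /\ (#|prodset A| <= M)%N.
  by rewrite leq_maxl leq_maxr.
set l := trunc_log 2 #|A|.
(* As |A| >= 2 gives l >= 1, one has l + 1 <= 2l <= (2 / ln 2) ln|A|. *)
have lel : ln l.+1%:R <= d + ln alpha.
  have l0 : (0 < l)%N by rewrite trunc_log_gt0.
  have lel : l%:R * ln 2 <= alpha by rewrite -lnX // leln ?expn_gt0 // trunc_logP.
  have c0 : 0 < 2 / ln 2 :> R by rewrite divr_gt0.
  rewrite /d -lnM ?posrE // ler_ln ?posrE ?ltr0n ?mulr_gt0 ?invr_gt0 //.
  rewrite mulrAC ler_pdivlMr // -natr1 mulrDl mul1r.
  have : ln 2 <= l%:R * ln 2 :> R by rewrite ler_peMl ?ler1n // ltW.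
  lra.
have := ler_norm (ln K%:R : R); have := ler_norm d; have := normr_ge0 d.
case: (HK p A M pr_p gtA leS leP) => [le14|le11] d0 led leK; [left|right].
  have := leln _ _ _ le14; rewrite !lnMn ?lnX ?muln_gt0 ?expn_gt0 ?A0 ?M0 ?K0 //.
  by move=> /(_ isT); rewrite -/alpha -/mu; lra.
have := leln _ _ _ le11; have p0 := prime_gt0 pr_p.
rewrite !lnMn ?lnX ?muln_gt0 ?expn_gt0 ?A0 ?M0 ?K0 ?p0 //.
by move=> /(_ isT); rewrite -/alpha -/mu; lra.
Qed.

Theorem theorem1 (R : realType) :
  (exists2 c : R, 0 < c &
    forall (p : nat) (A : {set 'F_p}), prime p -> (1 < #|A|)%N ->
      let a : R := #|A|%:R in
      let q : R := p%:R in
      c * Num.min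
            (a `^ (15 / 14) * Num.max 1 (a `^ (1 / 7) * q `^ (- (1 / 14)))
               / ln a `^ (2 / 7))
            (a `^ (11 / 12) * q `^ (1 / 12) / ln a `^ (1 / 3))
        <= (maxn #|sumset A| #|prodset A|)%:R)
  /\
  (exists2 c' : R, 0 < c' &
    forall (p : nat) (A : {set 'F_p}), prime p -> (1 < #|A|)%N ->
      let a : R := #|A|%:R in
      let q : R := p%:R in
      a < q `^ (7 / 13) * ln q `^ (- (4 / 13)) ->
      c' * (a `^ (15 / 14) / ln a `^ (2 / 7))
        <= (maxn #|sumset A| #|prodset A|)%:R).
Proof.
have powE (x y : R) : 0 < x -> x `^ y = expR (y * ln x).
  by move=> x0; rewrite /powR gt_eqF.
have ln2 : 0 < ln 2 :> R by rewrite ln_gt0 ?ltr1n.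
have lnA p (A : {set 'F_p}) : (1 < #|A|)%N -> ln 2 <= ln #|A|%:R :> R.
  by move=> gtA; rewrite ler_ln ?posrE ?ltr0n ?ler_nat // ltnW.
have [c c0 Hc] : exists2 c : R, 0 < c &
    forall (p : nat) (A : {set 'F_p}), prime p -> (1 < #|A|)%N ->
      let a : R := #|A|%:R in
      let q : R := p%:R in
      c * Num.min
            (a `^ (15 / 14) * Num.max 1 (a `^ (1 / 7) * q `^ (- (1 / 14)))
               / ln a `^ (2 / 7))
            (a `^ (11 / 12) * q `^ (1 / 12) / ln a `^ (1 / 3))
        <= (maxn #|sumset A| #|prodset A|)%:R.
  have [k Hk] := sum_product_dichotomy_ln R.
  (* The term |ln (ln 2)| is there because ln (ln |A|) enters with a negative coefficient and can
     itself be negative, though never below ln (ln 2). *)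
  exists (expR (- (`|k| + `|ln (ln 2)|))); first exact: expR_gt0.
  move=> p A pr_p gtA; cbv zeta; set a : R := #|A|%:R; set q : R := p%:R.
  have a0 : 0 < a by rewrite ltr0n ltnW.
  have q0 : 0 < q by rewrite ltr0n prime_gt0.
  have l0 : 0 < ln a by apply: lt_le_trans (lnA _ _ gtA).
  have lel : ln (ln 2) <= ln (ln a) by rewrite ler_ln ?posrE // lnA.
  have M0 : 0 < (maxn #|sumset A| #|prodset A|)%:R :> R.
    rewrite ltr0n leq_max; apply/orP; left.
    by apply: card_addset_gt0; rewrite -card_gt0 ltnW.
  have := Hk p A pr_p gtA; rewrite /= -/a -/q => {}Hk.
  rewrite !powE // -[leRHS]lnK ?posrE //.
  set mu := ln _%:R in Hk *.
  have nk := ler_norm k; have nk0 := normr_ge0 k.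
  have n2 := ler_norm (- ln (ln 2) : R); rewrite normrN in n2.
  have n20 := normr_ge0 (ln (ln 2) : R).
  set alpha := ln a in Hk l0 lel *; set pi := ln q in Hk *.
  set lambda := ln alpha in Hk lel *.
  have second : 11 / 12 * alpha + 1 / 12 * pi - 1 / 3 * lambda <= mu + (`|k| + `|ln (ln 2)|) ->
      expR (- (`|k| + `|ln (ln 2)|)) *
        (expR (11 / 12 * alpha) * expR (1 / 12 * pi) / expR (1 / 3 * lambda))
        <= expR mu.
    by move=> le; rewrite -!expRN -!expRD ler_expR; lra.
  have first : 15 / 14 * alpha - 2 / 7 * lambda <= mu + (`|k| + `|ln (ln 2)|) ->
      17 / 14 * alpha - 1 / 14 * pi - 2 / 7 * lambda <= mu + (`|k| + `|ln (ln 2)|) ->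
      expR (- (`|k| + `|ln (ln 2)|)) * (expR (15 / 14 * alpha) *
         Num.max 1 (expR (1 / 7 * alpha) * expR (- (1 / 14) * pi)) / expR (2 / 7 * lambda))
        <= expR mu.
    move=> le1 le2; rewrite maxEle; case: ifP => _.
      by rewrite -!expRN -!expRD ler_expR; lra.
    by rewrite mulr1 -!expRN -!expRD ler_expR; lra.
  rewrite minr_pMr ?expR_ge0 // ge_min; apply/orP.
  case: Hk => Hk; last by right; apply: second; lra.
  (* Both terms of the minimum are compared with |A|^(14/13): the first one is
     smaller up to |A| = p^(13/25), the second one is smaller beyond. *)
  have [le25|lt25] := leP (25 * alpha) (13 * pi).
    by left; apply: first; lra.
  by right; apply: second; lra.
split; first by exists c.
(* For a^13 (log a)^4 <= p^7 the first term of the minimum is the smaller one, up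
   to the factor max(1, .) >= 1. *)
exists c => // p A pr_p gtA a q lta.
apply: le_trans (Hc p A pr_p gtA); rewrite -/a -/q ler_pM2l //.
have a0 : 0 < a by rewrite ltr0n ltnW.
have q0 : 0 < q by rewrite ltr0n prime_gt0.
(* The hypothesis involves log p where the comparison needs log|A|; |A| <= p links the two. *)
have l0 : 0 < ln a by apply: lt_le_trans (lnA _ _ gtA).
have leaq : ln a <= ln q.
  by rewrite ler_ln ?posrE // ler_nat -[leqRHS](card_Fp pr_p) max_card.
have lq0 : 0 < ln q by apply: lt_le_trans leaq.
have lelaq : ln (ln a) <= ln (ln q) by rewrite ler_ln.
move: lta; rewrite !powE // -expRD -[ltLHS]lnK ?posrE // ltr_expR => lta.
rewrite le_min; apply/andP; split.
  by rewrite ler_pM2r ?invr_gt0 ?expR_gt0 // ler_peMr ?expR_ge0 // le_max lexx.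
by rewrite -!expRN -!expRD ler_expR; lra.
Qed.
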